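(* For long virtual knots $K$, the pair of Khovanov homologies $KH^{i,j}(p_r(K))$ and $KH^{i,j}(i(p(K)))$ is a stronger invariant than Manturov's Khovanov homology $KH^{i,j}(K)$. In other words, there exist two long virtual knots $K_1$ and $K_2$ such that $KH^{i,j}(p_r(K_1))\simeq KH^{i,j}(p_r(K_2))$ for all $(i,j)$ but $KH^{i,j}(i(p(K_1)))\not\simeq KH^{i,j}(i(p(K_2)))$ for some $(i,j)$.
   Context: All knots are oriented. A long virtual knot diagram is a generic immersion of the oriented line in the plane (standard outside a compact set; equivalently an oriented circle with a base point away from the double points), with finitely many transversal double points, each declared either a real crossing (with over/under information) or a virtual crossing. A long virtual knot is a class of such diagrams modulo planar isotopy, Reidemeister moves and virtual moves performed away from the base point. Closing the line (forgetting the base point) gives a virtual knot. The Gauss diagram of a (long) virtual knot diagram is the counterclockwise oriented circle (with base point in the long case) with one chord joining the two preimages of each real crossing; each chord carries the sign (local writhe) of the crossing and an arrow from the over-branch to the under-branch; virtual crossings are ignored. Gauss diagrams are considered up to orientation (and base point) preserving homeomorphism. A Gauss diagram determines a virtual diagram up to virtual moves, and long virtual knots are the same as based Gauss diagrams modulo the Gauss-diagram versions of the Reidemeister moves performed away from the base point. Map $p_r$: forgets the arrows of a Gauss diagram and keeps the signs of chords. Map $p$: for a based Gauss diagram $G$, call the first endpoint of a chord the endpoint met first when travelling along the oriented circle from the base point. The diagram $p(G)$ is the based circle with the same chords, with signs and arrows removed, where each chord is labelled $a$ if either (its sign is $+$ and its arrow points from the first endpoint to the second) or (its sign is $-$ and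 its arrow points from the second endpoint to the first), and is labelled $b$ otherwise. Map $i$ (not to be confused with the homological index $i$): for a based chord diagram with chords labelled $a$ or $b$, $i$ replaces each label $a$ by the sign $+$ and each label $b$ by the sign $-$, giving a based chord diagram whose chords carry signs but no arrows. Khovanov homology (Manturov, coefficients $\mathbb{Z}_2$): let $D$ be a virtual knot diagram with writhe $w(D)$. A state assigns a positive or negative marker to every real crossing and smooths accordingly; the positive marker is the Kauffman $A$-smoothing (so the orientation-respecting smoothing is the one given by the positive marker at a positive crossing and by the negative marker at a negative crossing). An enhanced state $S$ is a state with a label $1$ or $x$ on each circle, where $\deg(1)=1$, $\deg(x)=-1$. Let $\sigma(S)$ be the number of positive minus the number of negative markers, $\tau(S)$ the sum of degrees of labels, $i(S)=(w(D)-\sigma(S))/2$ and $j(S)=w(D)+i(S)+\tau(S)$. $C^{i,j}(D)$ is the $\mathbb{Z}_2$-vector space with basis the enhanced states with $i(S)=i$, $j(S)=j$. The differential $d:C^{i,j}(D)\to C^{i+1,j}(D)$ is $d(S)=\sum_T (S:T)\,T$, a sum over changes of one positive marker to a negative one: if two circles merge, labels change by $m(1\otimes 1)=1$, $m(1\otimes x)=m(x\otimes 1)=x$, $m(x\otimes x)=0$; if one circle splits into two, by $\Delta(1)=1\otimes x+x\otimes 1$, $\Delta(x)=x\otimes x$; if the number of circles does not change, the contribution is zero; labels of other circles are unchanged. $KH^{i,j}(D)$ is the resulting homology, an invariant of virtual knots. For a long virtual knot $K$, $KH^{i,j}(K)$ is that of the virtual knot obtained by forgetting the base point. For a chord diagram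 $P$ with signs but no arrows, $KH^{i,j}(P)$ is $KH^{i,j}$ of any Gauss diagram obtained from $P$ by choosing arrows (and forgetting any base point); by a theorem of Manturov this does not depend on the choice, so $KH^{i,j}(K)\simeq KH^{i,j}(p_r(K))$. $KH^{i,j}(i(p(K)))$ means $KH^{i,j}(i(p(D)))$ for any diagram $D$ of $K$, which does not depend on $D$ up to isomorphism. *)

(* Defs.v *)
From Stdlib Require Import Relations.Relation_Operators.
From HB Require Import structures.
From mathcomp Require Import all_boot all_order all_algebra.
From mathcomp Require Import ring_quotient.

Set Implicit Arguments.
Unset Strict Implicit.
Unset Printing Implicit Defensive.

Import GRing.Theory.
Local Open Scope ring_scope.

(* A based Gauss diagram is cut open at its base point and read along the
   oriented circle as a word, one letter per chord endpoint.  [over] holds at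
   the tail of the arrow (over-branch) and fails at its head (under-branch);
   [sgn] is [true] for a positive crossing. *)
Record letter := Letter { name : nat; over : bool; sgn : bool }.

Definition letter_tuple (l : letter) := (name l, over l, sgn l).
Definition tuple_letter (t : nat * bool * bool) := Letter t.1.1 t.1.2 t.2.
Lemma letter_tupleK : cancel letter_tuple tuple_letter. Proof. by case. Qed.
HB.instance Definition _ := Equality.copy letter (can_type letter_tupleK).

Definition mate (l : letter) := Letter (name l) (~~ over l) (sgn l).

Definition gauss_word (w : seq letter) : bool :=
  uniq [seq (name l, over l) | l <- w] && all (fun l => mate l \in w) w.

Record gauss_diagram := GaussDiagram {
  gword :> seq letter;
  gwordP : gauss_word gword }.

Definition relabel (f : nat -> nat) (l : letter) :=
  Letter (f (name l)) (over l) (sgn l).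

Definition ordered_pair (b : bool) (l1 l2 : letter) :=
  if b then [:: l1; l2] else [:: l2; l1].

(* The third Reidemeister move involves a top, a middle and a bottom strand,
   crossing at [tm] (top over middle), [tb] (top over bottom) and [mb] (middle
   over bottom), and reverses the order of the two crossings on each strand.
   [x], [y], [z] say whether the top strand meets [tm] before [tb], the middle
   one [tm] before [mb], the bottom one [tb] before [mb].  For directed lines
   with direction vectors t, m, b the signs are those of t x m, t x b, m x b,
   and the vertices of the triangle give Y m = X t + Z b where X, Y, Z have
   the signs x, y, z; taking cross products with b and t yields exactly the
   two parity conditions below. *)
Inductive move : seq letter -> seq letter -> Prop :=
| Relabelling f w : injective f -> move w [seq relabel f l | l <- w]
| Reidemeister1 c o e u v :
    move (u ++ v) (u ++ [:: Letter c o e; Letter c (~~ o) e] ++ v)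
| Reidemeister2 c d o e b u v w :
    move (u ++ v ++ w)
         (u ++ [:: Letter c o e; Letter d o (~~ e)]
            ++ v ++ ordered_pair b (Letter c (~~ o) e) (Letter d (~~ o) (~~ e))
            ++ w)
| Reidemeister3 tm tb mb etm etb emb x y z s1 s2 s3 u1 u2 u3 u4 :
    x (+) etb = y (+) emb -> y (+) etm = z (+) etb ->
    perm_eq [:: s1; s2; s3]
      [:: ordered_pair x (Letter tm true etm) (Letter tb true etb);
          ordered_pair y (Letter tm false etm) (Letter mb true emb);
          ordered_pair z (Letter tb false etb) (Letter mb false emb)] ->
    move (u1 ++ s1 ++ u2 ++ s2 ++ u3 ++ s3 ++ u4)
         (u1 ++ rev s1 ++ u2 ++ rev s2 ++ u3 ++ rev s3 ++ u4).

(* Names of new chords are fresh because both ends of a move are Gauss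
   diagrams. *)
Definition long_equiv : gauss_diagram -> gauss_diagram -> Prop :=
  clos_refl_sym_trans gauss_diagram (fun D D' => move D D').

Record long_virtual_knot := LongVirtualKnot {
  is_diagram_of : gauss_diagram -> Prop;
  _ : exists D, forall D', is_diagram_of D' <-> long_equiv D D' }.

Definition chord_word (L : eqType) (w : seq (nat * L)) : bool :=
  all (fun e => (count_mem e w == 2)
             && (count (fun e' => e'.1 == e.1) w == 2)) w.

Record chord_diagram (L : eqType) := ChordDiagram {
  cword :> seq (nat * L);
  cwordP : chord_word cword }.

Lemma uniq_map_inj_in (T T' : eqType) (f : T -> T') (s : seq T) :
  uniq (map f s) -> {in s &, injective f}.
Proof.
elim: s => //= x s IHs /andP[fx /IHs inj] a b; rewrite !inE.
case/predU1P=> [->|sa] /predU1P[->|sb] // e; last exact: inj.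
  by case/negP: fx; rewrite e map_f.
by case/negP: fx; rewrite -e map_f.
Qed.

Lemma gauss_word_same_name w l l' : gauss_word w -> l \in w -> l' \in w ->
  name l' = name l -> (l' == l) || (l' == mate l).
Proof.
case/andP=> uw /allP mw lw l'w en.
have inj : {in w &, injective (fun l => (name l, over l))}.
  exact: uniq_map_inj_in.
have [eo|no] := eqVneq (over l') (over l).
  by rewrite (inj l' l) ?eqxx //= en eo.
apply/orP; right; apply/eqP; apply: inj => //; first exact: mw.
by rewrite /= en; congr pair; move: no; case: (over l'); case: (over l).
Qed.

Lemma gauss_word_count w l : gauss_word w -> l \in w ->
  count (fun l' => name l' == name l) w = 2.
Proof.
move=> gw lw; have [uw' mw] := andP gw.
have uw := map_uniq uw'.
rewrite -size_filter.
have nm : mate l != l by case: (l) => c [] e; apply/eqP => -[].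
have : perm_eq [seq l' <- w | name l' == name l] [:: l; mate l].
  apply: uniq_perm; rewrite ?filter_uniq //= ?inE 1?eq_sym ?nm //.
  move=> l'; rewrite mem_filter !inE; apply/andP/idP.
    by case=> /eqP en l'w; apply: gauss_word_same_name gw _ _ _.
  case/orP=> /eqP->; first by rewrite eqxx.
  by rewrite eqxx (allP mw).
by move/perm_size.
Qed.

Lemma label_chord_word (L : eqType) (g : letter -> L) w :
  gauss_word w -> (forall l, g (mate l) = g l) ->
  chord_word [seq (name l, g l) | l <- w].
Proof.
move=> gw gm; apply/allP => _ /mapP[l lw ->]; rewrite !count_map.
have c2 := gauss_word_count gw lw.
rewrite (@eq_in_count _ _ (fun l' => name l' == name l)) ?c2 //.
move=> l' l'w /=; rewrite xpair_eqE; case: eqP => //= en.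
by case/orP: (gauss_word_same_name gw lw l'w en) => /eqP->; rewrite ?gm eqxx.
Qed.

Definition signed_chord_diagram := chord_diagram bool.

Definition p_r (D : gauss_diagram) : signed_chord_diagram :=
  ChordDiagram (@label_chord_word _ sgn D (gwordP D) (fun _ => erefl)).

Inductive ab_label := label_a | label_b.

Definition ab_bool l := if l is label_a then true else false.
Definition bool_ab b := if b then label_a else label_b.
Lemma ab_boolK : cancel ab_bool bool_ab. Proof. by case. Qed.
HB.instance Definition _ := Equality.copy ab_label (can_type ab_boolK).

(* The arrow of a chord points from its first endpoint to its second one iff
   the first endpoint is the over-branch. *)
Definition arrow_forward (w : seq letter) (c : nat) : bool :=
  over (nth (Letter c false false) w (index c [seq name l | l <- w])).

Definition ab_of (w : seq letter) (l : letter) : ab_label :=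
  if (sgn l && arrow_forward w (name l))
     || (~~ sgn l && ~~ arrow_forward w (name l))
  then label_a else label_b.

Definition p (D : gauss_diagram) : chord_diagram ab_label :=
  ChordDiagram (@label_chord_word _ (ab_of D) D (gwordP D) (fun _ => erefl)).

Definition ab_sign (l : ab_label) : bool :=
  match l with label_a => true | label_b => false end.

Lemma map_chord_word (L L' : eqType) (h : L -> L') (w : seq (nat * L)) :
  chord_word w -> chord_word [seq (e.1, h e.2) | e <- w].
Proof.
move=> /allP cw; apply/allP => _ /mapP[e ew ->]; rewrite !count_map.
have /andP[/eqP c1 /eqP c2] := cw _ ew.
have same : {in w, forall e', e'.1 == e.1 -> e' = e}.
  move=> e' e'w en; apply/eqP.
  have sub : subpred (pred1 e) (fun e' : nat * L => e'.1 == e.1).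
    by move=> a /eqP->; rewrite /= eqxx.
  have := count_predC (pred1 e) [seq a <- w | a.1 == e.1].
  rewrite size_filter c2 !count_filter.
  rewrite (@eq_count _ (predI _ _) (pred1 e)); last first.
    by move=> a /=; case: eqP => //= ->; rewrite eqxx.
  rewrite c1 => /eqP; rewrite -[X in _ == X]addn0 eqn_add2l => /eqP c0.
  apply/negPn/negP => ne.
  have : has (predI (predC (pred1 e)) (fun a => a.1 == e.1)) w.
    by apply/hasP; exists e' => //=; rewrite ne en.
  by rewrite has_count c0.
rewrite (@eq_in_count _ _ (fun e' => e'.1 == e.1)) ?c2 //=.
move=> e' e'w /=; rewrite xpair_eqE; case: eqP => //= /eqP en.
by rewrite (same _ e'w en) eqxx.
Qed.

Definition i_map (P : chord_diagram ab_label) : signed_chord_diagram :=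
  ChordDiagram (@map_chord_word _ _ ab_sign P (cwordP P)).

Section Homology.
Variables (K : fieldType) (U V W : vectType K).
Variables (f : 'Hom(U, V)) (g : 'Hom(V, W)).

Definition cycle : vectType K := subvs_of (lker g).

(* The boundaries are the elements of [limg f] lying in [lker g]; in a complex
   this is all of [limg f]. *)
Definition boundary : {pred cycle} := [pred z : cycle | vsval z \in limg f].

Lemma boundary_zmod_closed : zmod_closed boundary.
Proof.
split=> [|u v]; rewrite !inE ?raddf0 ?mem0v // => uB vB.
by rewrite raddfB rpredB.
Qed.
HB.instance Definition _ :=
  GRing.isZmodClosed.Build cycle boundary boundary_zmod_closed.

Definition homology := {ideal_quot boundary}.
HB.instance Definition _ := GRing.Zmodule.on homology.
HB.instance Definition _ := EqQuotient.on homology.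

Local Open Scope quotient_scope.

Lemma homology_eqP (u v : cycle) :
  \pi_homology u = \pi_homology v <-> u - v \in boundary.
Proof. by rewrite Quotient.idealrBE; split=> /eqP. Qed.

Definition homology_scale (a : K) (u : homology) : homology :=
  \pi_homology (a *: repr u).

Lemma pi_homology_scale a (u : cycle) :
  homology_scale a (\pi_homology u) = \pi_homology (a *: u).
Proof.
apply/homology_eqP; rewrite -scalerBr inE linearZ memvZ //.
have : \pi_homology (repr (\pi_homology u)) = \pi_homology u by rewrite reprK.
by move/homology_eqP.
Qed.

Let piD (u v : cycle) :
  \pi_homology (u + v) = \pi_homology u + \pi_homology v :> homology.
Proof. exact: pi_addr. Qed.

Lemma homology_scaleA a b u :
  homology_scale a (homology_scale b u) = homology_scale (a * b) u.
Proof. by elim/quotW: u => u; rewrite [homology_scale b _]pi_homology_scale !pi_homology_scale scalerA. Qed.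

Lemma homology_scale1 : left_id 1 homology_scale.
Proof. by elim/quotW => u; rewrite pi_homology_scale scale1r. Qed.

Lemma homology_scaleDr : right_distributive homology_scale +%R.
Proof.
move=> a; elim/quotW => u; elim/quotW => v.
by rewrite -piD !pi_homology_scale scalerDr piD.
Qed.

Lemma homology_scaleDl u : {morph homology_scale^~ u : a b / a + b}.
Proof.
elim/quotW: u => u a b.
by rewrite !pi_homology_scale scalerDl piD.
Qed.

HB.instance Definition _ := GRing.Zmodule_isLmodule.Build K homology
  homology_scaleA homology_scale1 homology_scaleDr homology_scaleDl.

End Homology.

Definition isomorphic (K : fieldType) (V W : lmodType K) : Prop :=
  exists f : {linear V -> W}, bijective f.

(* The complex of a Gauss diagram only depends on the chords and their signs,
   so it is defined without choosing arrows. *)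
Section Khovanov.
Variable P : signed_chord_diagram.

Definition names : seq nat := [seq e.1 | e <- P].

Definition chord := seq_sub (undup names).

Definition positive (c : chord) : bool := (ssval c, true) \in cword P.

Definition endpoint : finType := 'I_(size P).

Definition end_of (c : chord) (k : endpoint) : bool := nth 0%N names k == ssval c.

(* The circle is cut at the endpoints and at the base point into
   [(size P).+1] arcs; the endpoint k lies between arcs k and k + 1. *)
Definition arc : finType := 'I_(size P).+1.
Definition arc_in (k : endpoint) : arc := widen_ord (leqnSn _) k.
Definition arc_out (k : endpoint) : arc := lift ord0 k.

(* [true] is the positive marker. *)
Definition state := {ffun chord -> bool}.

Definition glued (s : state) (u v : arc) : bool :=
  (* at the base point, which is forgotten *)
  ((u == ord0) && (v == ord_max))
  || [exists c : chord, exists k : endpoint, exists l : endpoint,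
      [&& k != l, end_of c k, end_of c l &
          if s c == positive c
          (* orientation-respecting smoothing *)
          then (u == arc_in k) && (v == arc_out l)
          else (u == arc_in k) && (v == arc_in l)
               || (u == arc_out k) && (v == arc_out l)]].

Definition adjacent (s : state) : rel arc :=
  [rel u v | glued s u v || glued s v u].

(* The circles of a state are the connected components of [adjacent s]. *)
Definition same_circle (s : state) : rel arc := connect (adjacent s).

(* Labels of circles, [false] for 1 and [true] for x, are encoded as labels of
   arcs which are constant on each circle. *)
Definition constant_on_circles (S : state * {ffun arc -> bool}) : bool :=
  [forall u, forall v, same_circle S.1 u v ==> (S.2 u == S.2 v)].

Definition enhanced_state :=
  {S : state * {ffun arc -> bool} | constant_on_circles S}.

Definition marker (S : enhanced_state) : state := (val S).1.
Definition label (S : enhanced_state) : {ffun arc -> bool} := (val S).2.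

Definition pm (b : bool) : int := if b then 1 else - 1.

Definition writhe : int := \sum_(c : chord) pm (positive c).
Definition sigma (S : enhanced_state) : int := \sum_(c : chord) pm (marker S c).
(* [roots] picks one arc on each circle. *)
Definition tau (S : enhanced_state) : int :=
  \sum_(u in roots (adjacent (marker S))) pm (~~ label S u).
(* The numerator is even: both terms have the parity of the number of chords. *)
Definition ideg (S : enhanced_state) : int := ((writhe - sigma S) %/ 2)%Z.
Definition jdeg (S : enhanced_state) : int := writhe + ideg S + tau S.

(* Is [l] a term of m(l1 (x) l2)?  Is l1 (x) l2 a term of Delta(l)? *)
Definition m_term (l1 l2 l : bool) : bool :=
  match l1, l2 with
  | false, false => l == false
  | false, true | true, false => l == true
  | true, true => false
  end.
Definition Delta_term (l l1 l2 : bool) : bool :=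
  match l with
  | false => (l1 == false) && (l2 == true) || (l1 == true) && (l2 == false)
  | true => (l1 == true) && (l2 == true)
  end.

(* For both smoothings of a chord, the arcs before and after either of its
   endpoints k lie on the two different branches of the smoothing; they thus
   represent the one or two circles passing through that crossing, before as
   well as after the change of marker. *)
Definition incident_at (S T : enhanced_state) (c : chord) (k : endpoint) :=
  let a := arc_in k in let b := arc_out k in
  [&& end_of c k, marker S c, ~~ marker T c,
      [forall c', (c' != c) ==> (marker T c' == marker S c')],
      [forall u, [|| same_circle (marker S) a u, same_circle (marker S) b u
                   | label T u == label S u]] &
      if ~~ same_circle (marker S) a b
      then m_term (label S a) (label S b) (label T a)
      else if ~~ same_circle (marker T) a b
      then Delta_term (label S a) (label T a) (label T b)
      else false].

Definition incidence (S T : enhanced_state) : 'F_2 :=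
  [exists c, exists k, incident_at S T c k]%:R.

Definition basis (i j : int) :=
  {S : enhanced_state | (ideg S == i) && (jdeg S == j)}.

Definition chain (i j : int) : vectType 'F_2 := {ffun basis i j -> ('F_2)^o}.

Definition diff_fun (i i' j : int) (x : chain i j) : chain i' j :=
  [ffun T => \sum_(S : basis i j) x S * incidence (val S) (val T)].

Lemma diff_fun_is_linear i i' j : linear (@diff_fun i i' j).
Proof.
move=> a x y; apply/ffunP => T; rewrite !ffunE /= scaler_sumr -big_split /=.
by apply: eq_bigr => S _; rewrite !ffunE mulrDl -scalerAl.
Qed.
HB.instance Definition _ i i' j :=
  GRing.isLinear.Build 'F_2 (chain i j) (chain i' j) _ (@diff_fun i i' j)
    (@diff_fun_is_linear i i' j).

(* A change of one positive marker to a negative one raises [ideg] by 1, so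
   this is zero unless i' = i + 1; leaving i' free avoids casts between
   degrees i and (i - 1) + 1. *)
Definition diff (i i' j : int) : 'Hom(chain i j, chain i' j) :=
  linfun (@diff_fun i i' j).

Definition KH (i j : int) : lmodType 'F_2 :=
  homology (diff (i - 1) i j) (diff i (i + 1) j).

End Khovanov.

(* Main.v *)
(** Let two chords of sign [+] cross each other on the circle.  If both arrows
    point forward, [i o p] keeps the signs; if both point backward, it makes
    them [-], while [p_r] forgets the difference.  With two positive chords,
    the state with only negative markers has homological degree 2, whereas two
    negative chords leave nothing above degree 0.  In the positive case,
    changing either marker of that state fuses its two circles into one, so its
    incoming differentials are comultiplications; as [1 (x) 1] is not a term of
    [Delta], the state labelled by 1 is a cycle which is not a boundary. *)
Require Import Defs.
From Stdlib Require Import Relations.Relation_Operators.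
From mathcomp Require Import all_boot all_order all_algebra.
From mathcomp Require Import zify.

Set Implicit Arguments.
Unset Strict Implicit.
Unset Printing Implicit Defensive.

Import Order.TTheory GRing.Theory Num.Theory.
Local Open Scope ring_scope.

Section Homology.
Variables (K : fieldType) (U V W : vectType K).
Variables (f : 'Hom(U, V)) (g : 'Hom(V, W)).

Lemma homology_eq0 (h : homology f g) : (forall v : V, v = 0) -> h = 0.
Proof.
move=> V0; elim/quotW: h => z.
by rewrite -[RHS](reprK (0 : homology f g)); congr (\pi_(homology f g)%qT _);
  apply: val_inj; rewrite /= [LHS]V0 [RHS]V0.
Qed.

Lemma homology_neq0 (v : V) :
  v \in lker g -> v \notin limg f -> exists h : homology f g, h != 0.
Proof.
move=> vg vf; exists (\pi_(homology f g)%qT (Subvs vg)).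
apply/eqP => h0; have : \pi_(homology f g)%qT (Subvs vg) = \pi_(homology f g)%qT 0.
  by rewrite h0; apply/esym/pi_zeror.
move/homology_eqP.
by rewrite subr0 inE /=; apply/negP.
Qed.

End Homology.

Lemma isomorphic_refl (K : fieldType) (V : lmodType K) : isomorphic V V.
Proof. by exists idfun; exists idfun. Qed.

Lemma isomorphic_eq0 (K : fieldType) (V W : lmodType K) :
  isomorphic V W -> (forall w : W, w = 0) -> forall v : V, v = 0.
Proof.
case=> f [f' fK _] W0 v.
by rewrite -[v]fK -[RHS]fK; congr f'; rewrite [LHS]W0 [RHS]W0.
Qed.

Lemma chord_diagram_inj (L : eqType) : injective (@cword L).
Proof.
by move=> [u uP] [v vP] /= uv; case: v / uv vP => vP; congr ChordDiagram;
  apply: bool_irrelevance.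
Qed.

Definition knot_of (D : gauss_diagram) : long_virtual_knot :=
  @LongVirtualKnot (long_equiv D) (ex_intro _ D (fun _ => iff_refl _)).

Section Degrees.
Variable P : signed_chord_diagram.

Lemma card_chord : #|{: chord P}| = size (undup (names P)).
Proof. exact/card_seq_sub/undup_uniq. Qed.

Lemma writhe_const b : (forall c : chord P, positive c = b) ->
  writhe P = pm b *+ #|{: chord P}|.
Proof.
by move=> Pb; rewrite -sumr_const; apply: eq_bigr => c _; rewrite Pb.
Qed.

Lemma sigma_ge (S : enhanced_state P) : - #|{: chord P}|%:Z <= sigma S.
Proof.
rewrite -natz -mulNrn -sumr_const; apply: ler_sum => c _.
by rewrite /pm; case: ifP.
Qed.

End Degrees.

Section AllOnes.
Variables (P : signed_chord_diagram) (s : state P).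

Lemma constant_ones : constant_on_circles (s, [ffun=> false]).
Proof. by apply/'forall_forallP => u v; rewrite !ffunE eqxx implybT. Qed.

Definition ones_state : enhanced_state P := Sub _ constant_ones.

End AllOnes.

Section NonTrivial.
Variables (P : signed_chord_diagram) (i j : int) (T : basis P i j).

(** The basis vector of [T] is a cycle because no differential leaves [T], and it is not a boundary
    because every boundary has coefficient 0 at [T]. *)
Lemma KH_neq0 :
  (forall S, incidence S (val T) = 0) -> (forall S, incidence (val T) S = 0) ->
  exists h : KH P i j, h != 0.
Proof.
move=> into out; pose v : chain P i j := [ffun S => (S == T)%:R].
apply: (@homology_neq0 _ _ _ _ _ _ v).
  rewrite memv_ker lfunE; apply/eqP/ffunP => S; rewrite !ffunE big1 // => S' _.
  by rewrite ffunE; case: eqP => [->|]; rewrite ?out ?mulr0 ?mul0r.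
apply/memv_imgP => -[u _ /ffunP/(_ T)]; rewrite lfunE !ffunE eqxx big1.
  by move/eqP; rewrite oner_eq0.
by move=> S _; rewrite into mulr0.
Qed.

End NonTrivial.

Lemma gauss_word_crossing b :
  gauss_word [:: Letter 0 b true; Letter 1 b true;
                 Letter 0 (~~ b) true; Letter 1 (~~ b) true].
Proof. by case: b. Qed.

(** Two interleaved positive chords, with both arrows pointing forward if [b] holds and backward
    otherwise. *)
Definition crossing b := GaussDiagram (gauss_word_crossing b).

Lemma chord_word_crossing (b : bool) : chord_word [:: (0, b); (1, b); (0, b); (1, b)]%N.
Proof. by case: b. Qed.

Definition crossing_chords b := ChordDiagram (chord_word_crossing b).

Lemma p_r_crossing b : p_r (crossing b) = crossing_chords true.
Proof. exact: chord_diagram_inj. Qed.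

Lemma i_map_p_crossing b : i_map (p (crossing b)) = crossing_chords b.
Proof. by apply: chord_diagram_inj; case: b. Qed.

Lemma positive_crossing b (c : chord (crossing_chords b)) : positive c = b.
Proof.
case: c => c cP; rewrite /positive /= !inE !xpair_eqE.
by move: cP; case: b; rewrite /= !inE => /orP[] /eqP->.
Qed.

Lemma writhe_crossing b : writhe (crossing_chords b) = pm b *+ 2.
Proof. by rewrite (writhe_const (@positive_crossing b)) card_chord. Qed.

(** The writhe is -2 and [sigma] is at least -2, so the numerator in [ideg] is never positive. *)
Lemma ideg_crossing_negative (S : enhanced_state (crossing_chords false)) :
  ideg S <= 0.
Proof.
have := sigma_ge S; rewrite /ideg writhe_crossing card_chord /=.
move: (sigma S) => x /=; lia.
Qed.

Local Notation P := (crossing_chords true).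

Definition all_negative : enhanced_state P := ones_state [ffun=> false].

Lemma ideg_all_negative : ideg all_negative = 2.
Proof.
rewrite /ideg writhe_crossing; have -> // : sigma all_negative = - 2.
rewrite /sigma (eq_bigr (fun=> -1)) => [|c _]; last by rewrite /marker /= ffunE.
by rewrite sumr_const card_chord.
Qed.

Lemma incidence_from_negative S : incidence all_negative S = 0.
Proof.
rewrite /incidence; case: existsP => // -[c /existsP[k]].
by case/and3P=> _; rewrite /marker /= ffunE.
Qed.


Section Circles.
Variable s : state P.

Lemma same_circle_sym : symmetric (same_circle s).
Proof. by apply: sym_connect_sym => a b; apply: orbC. Qed.

(** With arcs written as [inord] of a number, a path along a circle becomes a list of arc numbers
    from 0 to 4. *)
Lemma arc_inE (k : endpoint P) : arc_in k = inord k :> Defs.arc P.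
Proof. by apply: val_inj; rewrite /= inordK // ltnW // ltnS. Qed.

Lemma arc_outE (k : endpoint P) : arc_out k = inord k.+1 :> Defs.arc P.
Proof. by apply: val_inj; rewrite /= inordK // ltnS. Qed.

(** Arcs 0 and 4 are the two ends of the line, rejoined when the base point is forgotten. *)
Lemma same_circle_base : same_circle s (inord 0) (inord 4).
Proof.
apply/connect1/orP; left; apply/orP; left.
by apply/andP; split; apply/eqP/val_inj; rewrite /= inordK.
Qed.

(** Both chords are positive, so it is the positive marker that respects the orientation. *)
Lemma same_circle_smoothing (c : chord P) (k l : nat) :
  k != l -> (k < 4)%N -> (l < 4)%N ->
  nth 0%N (names P) k = ssval c -> nth 0%N (names P) l = ssval c ->
  if s c then same_circle s (inord k) (inord l.+1)
  else same_circle s (inord k) (inord l)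
       && same_circle s (inord k.+1) (inord l.+1).
Proof.
move=> kl k4 l4 ck cl.
pose k' : endpoint P := Ordinal (k4 : (k < size P)%N).
pose l' : endpoint P := Ordinal (l4 : (l < size P)%N).
have kl' : k' != l' by [].
have ck' : end_of c k' by apply/eqP.
have cl' : end_of c l' by apply/eqP.
rewrite -[k]/(val k') -[l]/(val l') -!arc_inE -!arc_outE.
case sc: (s c); [|apply/andP; split];
  apply/connect1/orP; left; apply/orP; right;
  apply/existsP; exists c; apply/existsP; exists k'; apply/existsP; exists l';
  by rewrite kl' ck' cl' positive_crossing sc /= !eqxx ?orbT.
Qed.

Lemma mem_chord0 : 0%N \in undup (names P). Proof. by []. Qed.
Lemma mem_chord1 : 1%N \in undup (names P). Proof. by []. Qed.
Definition chord0 : chord P := SeqSub mem_chord0.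
Definition chord1 : chord P := SeqSub mem_chord1.

Lemma chordP (c : chord P) : c = chord0 \/ c = chord1.
Proof.
have : ssval c \in [:: 0; 1]%N by exact: (ssvalP c).
by rewrite !inE => /orP[] /eqP cE; [left|right]; apply: val_inj.
Qed.

(** For interleaved chords, one positive and one negative marker leave a single circle through all
    five arcs. *)
Lemma same_circle_single_positive (c : chord P) (k : endpoint P) :
  s c -> (forall c', c' != c -> ~~ s c') -> end_of c k ->
  same_circle s (arc_in k) (arc_out k).
Proof.
have tr : transitive (same_circle s) by apply: connect_trans.
move=> sc /[dup] /(_ chord0) s0 /(_ chord1) s1.
have in0 := @same_circle_smoothing chord0 0 2 isT isT isT erefl erefl.
have in2 := @same_circle_smoothing chord0 2 0 isT isT isT erefl erefl.
have in1 := @same_circle_smoothing chord1 1 3 isT isT isT erefl erefl.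
have in3 := @same_circle_smoothing chord1 3 1 isT isT isT erefl erefl.
have base := same_circle_base.
rewrite arc_inE arc_outE /end_of.
case: (chordP c) => cE; rewrite {}cE in sc s0 s1 *.
- move: in0 in2 in1; rewrite sc (negbTE (s1 isT)) => in0 in2 /andP[in1 out1].
  (* Endpoints 0 and 2 lie on [chord0]; the paths are 0-3-1 and 2-1-3. *)
  case: k => -[|[|[|[|//]]]] //= _ _.
  + by apply: tr in0 _; rewrite same_circle_sym.
  + exact: tr in2 in1.
- move: in1 in3 in0; rewrite sc (negbTE (s0 isT)) => in1 in3 /andP[in0 out0].
  (* Endpoints 1 and 3 lie on [chord1]; the paths 1-4-0-2 and 3-2-0-4 pass through the base
     point. *)
  case: k => -[|[|[|[|//]]]] //= _ _.
  + rewrite same_circle_sym; apply: tr (tr _ _ _ base _).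
      by rewrite same_circle_sym.
    by rewrite same_circle_sym.
  + apply: tr in3 (tr _ _ _ _ base).
    by rewrite same_circle_sym.
Qed.

End Circles.

Lemma incidence_to_negative S : incidence S all_negative = 0.
Proof.
rewrite /incidence; case: existsP => // -[c /existsP[k]].
case/and5P=> ck Sc _ /forallP/= Sother /andP[_].
(* A single circle of [S] meets the crossing, so a merge is excluded; a split would need both labels
   1 in a term of [Delta]. *)
rewrite (same_circle_single_positive Sc _ ck) /= => [|c' /(implyP (Sother c'))].
  by case: ifP => // _; case: (label S _); rewrite /label /= !ffunE.
(* Away from [c] the markers of [S] are those of [all_negative], so [c] carries the only positive
   one. *)
by rewrite /marker /= ffunE => /eqP <-.
Qed.

Theorem theorem4p3 :
  exists (K1 K2 : long_virtual_knot) (D1 D2 : gauss_diagram),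
    is_diagram_of K1 D1 /\ is_diagram_of K2 D2 /\
    (forall i j : int, isomorphic (KH (p_r D1) i j) (KH (p_r D2) i j)) /\
    (exists i j : int,
       ~ isomorphic (KH (i_map (p D1)) i j) (KH (i_map (p D2)) i j)).
Proof.
exists (knot_of (crossing true)), (knot_of (crossing false)).
exists (crossing true), (crossing false).
split; [exact: rst_refl | split; [exact: rst_refl | split]].
  by move=> i j; rewrite !p_r_crossing; apply: isomorphic_refl.
(* Taking the second degree from the surviving state itself avoids counting circles. *)
exists 2, (jdeg all_negative); rewrite !i_map_p_crossing => iso.
have bP : (ideg all_negative == 2) && (jdeg all_negative == jdeg all_negative).
  by rewrite ideg_all_negative !eqxx.
have [h /eqP h0] := KH_neq0 (T := Sub all_negative bP)
  incidence_to_negative incidence_from_negative.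
(* For negative chords no enhanced state has degree 2, so the chain space itself is zero. *)
apply: h0; apply: (isomorphic_eq0 iso) => {}h; apply: homology_eq0 => v.
apply/ffunP => -[S SP]; have /andP[/eqP S2 _] := SP.
by have := ideg_crossing_negative S; rewrite S2.
Qed.
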